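(* Let $f$ be a regulated function on $[a,b]$, and let $\lambda\in\Lambda[a,b]$ be such that $\{t\in(a,b):\Delta^-f(t)\,\Delta^+f(t)\ne0\}\subset\cup\lambda$. If the product integral of $f$ over $[a,b]$, $\prod_a^b(1+df)$, exists and is non-zero, then the product $\lambda$-integral $\prod(1+d_\lambda f)$ is defined on $[a,b]$, and the product integral and the product $\lambda$-integral have the same values on $S[\![a,b]\!]$, that is, $\prod_u^v(1+d_\lambda f)=\prod_u^v(1+df)$ for all $(u,v)\in S[\![a,b]\!]$.
   Context: Fix real $a<b$. A function $f:[a,b]\to\mathbb R$ is regulated if the finite limits $f(t-)$, $t\in(a,b]$, and $f(s+)$, $s\in[a,b)$, exist; $\Delta^-f(t)=f(t)-f(t-)$ and $\Delta^+f(s)=f(s+)-f(s)$. $\Lambda[a,b]$ is the set of sequences $\lambda=\{\lambda_m:m\ge1\}$ of partitions (finite sets $a=t_0<\dots<t_n=b$) of $[a,b]$ with $\lambda_m\subset\lambda_{m+1}$ and $\cup\lambda:=\bigcup_m\lambda_m$ dense in $[a,b]$. For $a\le s<t\le b$ let $\lambda_m|_{[s,t]}=\{s,t\}\cup(\lambda_m\cap(s,t))=\{s=x_0<\dots<x_n=t\}$. Extended interval: $[\![a,b]\!]$ consists of the points of $[a,b]$ together with the symbols $t-$ ($a<t\le b$) and $t+$ ($a\le t<b$), linearly ordered by $z+<x-<x<x+<y-$ for $z<x<y$; $S[\![a,b]\!]=\{(u,v):u,v\in[\![a,b]\!],\,u\le v\}$. A regulated function $f$ is extended to $[\![a,b]\!]$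 by its one-sided limits. Product integral: for $u<v$ in $[\![a,b]\!]$, $\prod_u^v(1+df)$ is the limit under refinement of the finite products $\prod_{i=1}^n[1+f(x_i)-f(x_{i-1})]$ over $u=x_0<x_1<\dots<x_n=v$ with $x_1,\dots,x_{n-1}\in[a,b]$, provided it exists (for $u=a,v=b$ this is the usual product integral, the limit over partitions of $[a,b]$ directed by refinement); $\prod_u^u(1+df)=1$. Product $\lambda$-integral: it is defined on $[a,b]$ if there is a regulated function $G$ on $[a,b]$ with $G(a)=1$, $\inf|G|>0$ and, for all $a\le s<t\le b$, $G(t)/G(s)=\lim_{m\to\infty}\prod_i[1+f(x_i)-f(x_{i-1})]$ (product over $\lambda_m|_{[s,t]}$), $G(t)/G(t-)=1+\Delta^-f(t)$, $G(s+)/G(s)=1+\Delta^+f(s)$; then $\prod_u^v(1+d_\lambda f):=G(v)/G(u)$ for $(u,v)\in S[\![a,b]\!]$. *)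

(* Defs.v *)
From HB Require Import structures.
From mathcomp Require Import all_boot all_order all_algebra.
From mathcomp Require Import all_classical all_reals all_analysis.
Set Implicit Arguments.
Unset Strict Implicit.
Unset Printing Implicit Defensive.
Import Order.TTheory GRing.Theory Num.Theory.
Import numFieldNormedType.Exports.
Local Open Scope classical_set_scope.
Local Open Scope ring_scope.

(* A function on [a, b] is represented by a function on R; every notion below
   depends only on its values on [a, b]. *)

Definition regulated (R : realType) (a b : R) (f : R -> R) : Prop :=
  (forall t, a < t <= b -> cvg (f x @[x --> t^'-])) /\
  (forall s, a <= s < b -> cvg (f x @[x --> s^'+])).

Definition left_jump (R : realType) (f : R -> R) (t : R) : R :=
  f t - lim (f x @[x --> t^'-]).

Definition right_jump (R : realType) (f : R -> R) (s : R) : R :=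
  lim (f x @[x --> s^'+]) - f s.

(* Lft t, Pt t and Rgt t stand for the symbols t-, t and t+. *)
Inductive xpoint (R : realType) : Type :=
  | Lft of R
  | Pt of R
  | Rgt of R.

Definition xbase (R : realType) (u : xpoint R) : R :=
  match u with Lft t => t | Pt t => t | Rgt t => t end.

Definition xrank (R : realType) (u : xpoint R) : nat :=
  match u with Lft _ => 0%N | Pt _ => 1%N | Rgt _ => 2%N end.

(* z+ < x- < x < x+ < y- for z < x < y, that is, the lexicographic order. *)
Definition xlt (R : realType) : rel (xpoint R) := fun u v =>
  (xbase u < xbase v) || ((xbase u == xbase v) && (xrank u < xrank v)%N).

Definition xitv (R : realType) (a b : R) : set (xpoint R) :=
  [set u | match u with
           | Lft t => a < t <= b
           | Pt t => a <= t <= b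
           | Rgt t => a <= t < b
           end].

Definition xsimplex (R : realType) (a b : R) : set (xpoint R * xpoint R) :=
  [set uv | [/\ xitv a b uv.1, xitv a b uv.2 & uv.1 = uv.2 \/ xlt uv.1 uv.2]].

Definition xext (R : realType) (f : R -> R) (u : xpoint R) : R :=
  match u with
  | Lft t => lim (f x @[x --> t^'-])
  | Pt t => f t
  | Rgt t => lim (f x @[x --> t^'+])
  end.

(* A partition u = x_0 < x_1 < ... < x_n = v whose interior points are real is
   encoded by its list of interior points s = [:: x_1; ...; x_(n-1)]. *)
Definition xpartition (R : realType) (a b : R) (u v : xpoint R) (s : seq R) :
    Prop :=
  path (@xlt R) u (rcons (map (@Pt R) s) v) /\ all (fun x => a <= x <= b) s.

Definition xprod (R : realType) (f : R -> R) (u v : xpoint R) (s : seq R) : R :=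
  \prod_(y <- pairmap (fun p q => 1 + (xext f q - xext f p)) u
                (rcons (map (@Pt R) s) v)) y.

Definition refinement (R : realType) (a b : R) (u v : xpoint R) :
    set_system (seq R) :=
  filter_from (xpartition a b u v)
    (fun s => [set s' | xpartition a b u v s' /\ {subset s <= s'}]).

Definition prod_integrable (R : realType) (a b : R) (f : R -> R)
    (u v : xpoint R) : Prop :=
  u = v \/ cvg (xprod f u v s @[s --> refinement a b u v]).

Definition prod_integral (R : realType) (a b : R) (f : R -> R)
    (u v : xpoint R) : R :=
  if `[< u = v >] then 1 else lim (xprod f u v s @[s --> refinement a b u v]).

(* As usual with itv_partition, lam m lists the points of the m-th partition
   (m = 0, 1, ...) in increasing order, without the first point a. *)
Definition partition_points (R : realType) (a : R) (lam : nat -> seq R) :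
    set R :=
  [set x | exists m, x \in a :: lam m].

Definition Lambda (R : realType) (a b : R) : set (nat -> seq R) :=
  [set lam | [/\ forall m, itv_partition a b (lam m),
                 forall m, {subset lam m <= lam m.+1}
               & `[a, b] `<=` closure (partition_points a lam)]].

(* The filtered list is the list of interior points of lam m restricted to
   [s, t]. *)
Definition lprod (R : realType) (lam : nat -> seq R) (f : R -> R) (s t : R)
    (m : nat) : R :=
  xprod f (Pt s) (Pt t) [seq x <- lam m | s < x < t].

Definition lprod_primitive (R : realType) (a b : R) (lam : nat -> seq R)
    (f G : R -> R) : Prop :=
  [/\ regulated a b G,
      G a = 1,
      0 < inf [set `|G t| | t in `[a, b]],
      forall s t, a <= s -> s < t -> t <= b ->
        lprod lam f s t m @[m --> \oo] --> G t / G s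
    & (forall t, a < t <= b -> G t / xext G (Lft t) = 1 + left_jump f t) /\
      (forall s, a <= s < b -> xext G (Rgt s) / G s = 1 + right_jump f s)].

Definition lprod_integrable (R : realType) (a b : R) (lam : nat -> seq R)
    (f : R -> R) : Prop :=
  exists G, lprod_primitive a b lam f G.

(* The values of G on [a, b] are determined by lprod_primitive, so the choice
   of G is immaterial. *)
Definition lprod_integral (R : realType) (a b : R) (lam : nat -> seq R)
    (f : R -> R) (u v : xpoint R) : R :=
  let G : R -> R := get [set G | lprod_primitive a b lam f G] in
  xext G v / xext G u.

(* Main.v *)
Require Import Defs.
From mathcomp Require Import all_boot all_order all_algebra.
From mathcomp Require Import all_classical all_reals all_analysis.
From mathcomp Require Import ring lra.
Import Order.TTheory GRing.Theory Num.Theory.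
Import numFieldNormedType.Exports.
Set Implicit Arguments.
Unset Strict Implicit.
Unset Printing Implicit Defensive.
Local Open Scope classical_set_scope.
Local Open Scope ring_scope.

(** The idea is to compare every product with a single function G. Write
    X(u, v, l) for the product of the factors 1 + f(q) - f(p) along a chain
    u < l < v of the extended interval, f being extended by its one-sided
    limits.

    Since the refinement limit P over [a, b] is not zero, two fine chains from
    a to u can both be completed by the same fine chain from u to b; the two
    completed products are close to P, so the common tail is not zero and
    cancels. Hence chain products from a to u are Cauchy for the relative
    distance, uniformly in u ([chain_prods_relatively_cauchy]). Chains through
    symbols t- and t+ are allowed here because replacing a symbol by a nearby
    real point changes the product by little ([chain_prod_close]). The limits
    G(u), the product integrals from a to u, are therefore not zero, and for
    each e > 0 there is one finite set s0 such that X(u, v, l) equals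
    G(v) / G(u) up to relative error e for all u < v and all chains l through
    the points of s0 between u and v ([prod_integral_approximates]).

    The rest follows from this uniform approximation. Arbitrary endpoints give
    the product integrals over all of S[[a, b]]; chains with empty interior
    give the one-sided limits of G and, with D^- f and D^+ f for the left and
    right jumps, G(t) = G(t-) (1 + D^- f(t)) and G(s+) = G(s) (1 + D^+ f(s)),
    so that no factor 1 + D^- f or 1 + D^+ f vanishes; and
    compactness of [a, b] bounds |G| away from zero.

    For the lambda-products, add the points of s0 to the m-th partition
    restricted to [s, t] one at a time ([insertion_ratio_cvg]). Once m is large,
    adding z changes the product only when z lies in no partition, and then
    one factor 1 + f(y) - f(x) is replaced by
    (1 + f(z) - f(x)) (1 + f(y) - f(z)), where x increases to z and y
    decreases to z because the partitions are dense. The limits of the two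
    expressions differ by D^- f(z) D^+ f(z), which is zero for such z, so the
    quotient tends to 1. Thus the lambda-products agree, up to a factor tending
    to 1, with products through s0, which are within relative error e of
    G(t) / G(s). *)

(** * Order and chains of the extended interval *)

Lemma xlt_trans (R : realType) : transitive (@xlt R).
Proof.
move=> v u w; rewrite /xlt => /orP[uv|/andP[/eqP uv ruv]].
  move=> /orP[vw|/andP[/eqP <- _]]; first by rewrite (lt_trans uv vw).
  by rewrite uv.
rewrite uv => /orP[->//|/andP[-> rvw]].
by rewrite (ltn_trans ruv rvw) orbT.
Qed.

Lemma xltxx (R : realType) (u : xpoint R) : xlt u u = false.
Proof. by rewrite /xlt ltxx eqxx ltnn. Qed.

Lemma xlt_PtE (R : realType) (x y : R) : xlt (Pt x) (Pt y) = (x < y).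
Proof. by rewrite /xlt /= ltnn andbF orbF. Qed.

Lemma xlt_baseW (R : realType) (u v : xpoint R) : xlt u v -> xbase u <= xbase v.
Proof. by rewrite /xlt => /orP[/ltW|/andP[/eqP->]]. Qed.

Lemma xlt_ltbase (R : realType) (u v : xpoint R) : xbase u < xbase v -> xlt u v.
Proof. by rewrite /xlt => ->. Qed.

(** Membership is a condition on the order alone, so it never has to be tracked
    along a chain once it is known for the endpoints. *)
Lemma xitvE (R : realType) (a b : R) (u : xpoint R) : a < b ->
  xitv a b u <-> (u = Pt a \/ xlt (Pt a) u) /\ (u = Pt b \/ xlt u (Pt b)).
Proof.
move=> ab; split.
- case: u => t /= /andP[at_ tb]; rewrite /xlt /= ?andbF ?andbT ?orbF.
  + by split; right; rewrite // orbC -le_eqVlt.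
  + split.
      by move: at_; rewrite le_eqVlt => /orP[/eqP->|]; [left|right].
    by move: tb; rewrite le_eqVlt => /orP[/eqP->|]; [left|right].
  + by split; right; rewrite // orbC -le_eqVlt.
- case: u => t /= [A B].
  + case: A => //; case: B => //; rewrite /xlt /= ?andbF ?andbT ?orbF.
    by rewrite orbC -le_eqVlt => -> ->.
  + apply/andP; split; first by case: A => [[->]//|/xlt_baseW].
    by case: B => [[->]//|/xlt_baseW].
  + case: A => //; case: B => //; rewrite /xlt /= ?andbF ?andbT ?orbF.
    by rewrite [(a < t) || _]orbC -le_eqVlt => -> ->.
Qed.

Lemma xitv_between (R : realType) (a b : R) (u v w : xpoint R) : a < b ->
  xitv a b u -> xitv a b w -> xlt u v -> xlt v w -> xitv a b v.
Proof.
move=> ab /(xitvE _ ab)[A _] /(xitvE _ ab)[_ B] uv vw; apply/(xitvE _ ab).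
split; right.
  by case: A => [<-//|]; move/xlt_trans; apply.
by case: B => [<-//|]; apply: xlt_trans vw.
Qed.

(** Interior points are arbitrary extended points here, whereas those of an
    [xpartition] are real: this makes concatenation at a symbol t- or t+
    available. *)
Definition chain (R : realType) (u v : xpoint R) (l : seq (xpoint R)) : bool :=
  path (@xlt R) u (rcons l v).

(** [xprod f u v s] unfolds to [chain_prod (xext f) u v (map (@Pt R) s)]. *)
Definition chain_prod (R : realType) (F : xpoint R -> R) (u v : xpoint R)
    (l : seq (xpoint R)) : R :=
  \prod_(y <- pairmap (fun p q => 1 + (F q - F p)) u (rcons l v)) y.

Definition reals (R : realType) (l : seq (xpoint R)) : seq R :=
  pmap (fun p => if p is Pt x then Some x else None) l.

(** Only the points of [s0] strictly between the endpoints are required, so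
    that one set [s0] can serve all intervals at once. *)
Definition covers (R : realType) (s0 : seq R) (u v : xpoint R)
    (l : seq (xpoint R)) : Prop :=
  forall x, x \in s0 -> xlt u (Pt x) -> xlt (Pt x) v -> x \in reals l.

(** The canonical chain covering [s0]. Sorting makes it depend on the members
    of [s0] only, so unions of partitions are just concatenated lists. *)
Definition between (R : realType) (s0 : seq R) (u v : xpoint R) : seq R :=
  [seq x <- sort <=%R (undup s0) | xlt u (Pt x) && xlt (Pt x) v].

Lemma reals_Pt (R : realType) (s : seq R) : reals (map (@Pt R) s) = s.
Proof. by elim: s => //= x s ->. Qed.

Lemma reals_cat (R : realType) (l1 l2 : seq (xpoint R)) :
  reals (l1 ++ l2) = reals l1 ++ reals l2.
Proof. exact: pmap_cat. Qed.

Lemma mem_between (R : realType) (s0 : seq R) (u v : xpoint R) (x : R) :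
  (x \in between s0 u v) = [&& x \in s0, xlt u (Pt x) & xlt (Pt x) v].
Proof. by rewrite mem_filter mem_sort mem_undup andbC. Qed.

Lemma between_sorted (R : realType) (s0 : seq R) (u v : xpoint R) :
  sorted <%R (between s0 u v).
Proof.
apply: sorted_filter; first exact: lt_trans.
by rewrite sort_lt_sorted undup_uniq.
Qed.

Lemma covers_between (R : realType) (s0 s1 : seq R) (u v : xpoint R) :
  {subset s0 <= s1} -> covers s0 u v (map (@Pt R) (between s1 u v)).
Proof.
by move=> s01 x xs0 ux xv; rewrite reals_Pt mem_between s01//= ux xv.
Qed.

Lemma chain_Pt (R : realType) (u v : xpoint R) (s : seq R) :
  chain u v (map (@Pt R) s) =
  [&& xlt u v, sorted <%R s & all (fun x => xlt u (Pt x) && xlt (Pt x) v) s].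
Proof.
rewrite /chain path_sortedE; last exact: xlt_trans.
rewrite sorted_pairwise; last exact: xlt_trans.
rewrite pairwise_rcons all_rcons !all_map pairwise_map.
have -> : pairwise (relpre (@Pt R) (@xlt R)) s = sorted <%R s.
  rewrite sorted_pairwise; last exact: lt_trans.
  by apply: eq_pairwise => x y; rewrite /= xlt_PtE.
rewrite all_predI; case: (xlt u v) => //=.
by rewrite andbA andbC.
Qed.

Lemma chain_between (R : realType) (s0 : seq R) (u v : xpoint R) : xlt u v ->
  chain u v (map (@Pt R) (between s0 u v)).
Proof.
move=> uv; rewrite chain_Pt uv between_sorted /=.
by apply/allP => x; rewrite mem_between => /and3P[_ -> ->].
Qed.

Lemma chain_cat (R : realType) (u v w : xpoint R) l1 l2 :
  chain u w (l1 ++ v :: l2) = chain u v l1 && chain v w l2.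
Proof. by rewrite /chain -cat_rcons rcons_cat cat_path last_rcons. Qed.

Lemma chain_prod_cat (R : realType) (F : xpoint R -> R) (u v w : xpoint R)
    l1 l2 :
  chain_prod F u w (l1 ++ v :: l2) = chain_prod F u v l1 * chain_prod F v w l2.
Proof.
rewrite /chain_prod -cat_rcons rcons_cat pairmap_cat big_cat /=.
by rewrite last_rcons.
Qed.

Lemma chain_xlt (R : realType) (u v : xpoint R) l : chain u v l -> xlt u v.
Proof.
rewrite /chain path_sortedE; last exact: xlt_trans.
by rewrite all_rcons => /andP[/andP[]].
Qed.

Lemma covers_cat (R : realType) (s0 : seq R) (u v w : xpoint R) l1 l2 :
  covers s0 u v l1 -> covers s0 v w l2 -> covers s0 u w (l1 ++ v :: l2).
Proof.
move=> C1 C2 x xs0 ux xw; rewrite -cat_rcons -cats1 !reals_cat !mem_cat.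
have [xv|nxv] := boolP (xlt (Pt x) v); first by rewrite C1.
have [vx|nvx] := boolP (xlt v (Pt x)); first by rewrite C2 ?orbT.
(* The junction [v] itself is the remaining point that [s0] may contain. *)
suff -> : v = Pt x by rewrite /= inE eqxx orbT.
move: nxv nvx; rewrite /xlt; case: v {C1 C2} => y /=;
  by case: ltgtP => //= ->.
Qed.

(** The effect of one more point [z] on a product is confined to the factor
    of the gap that it splits; [A] and [B] are the products before and after
    that gap. They may vanish, so the two products are given separately and
    not as a quotient. *)
Lemma chain_prod_insert (R : realType) (F : xpoint R -> R) (u v : xpoint R)
    l1 l2 :
  exists A B,
  chain_prod F u v (l1 ++ l2) = A * (1 + (F (head v l2) - F (last u l1))) * B /\
  forall z, chain_prod F u v (l1 ++ z :: l2) =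
    A * ((1 + (F z - F (last u l1))) * (1 + (F (head v l2) - F z))) * B.
Proof.
pose g p q := 1 + (F q - F p).
exists (\prod_(y <- pairmap g u l1) y).
exists (\prod_(y <- pairmap g (head v l2) (behead (rcons l2 v))) y).
split => [|z]; rewrite /chain_prod rcons_cat pairmap_cat big_cat /= -mulrA.
  by congr (_ * _); case: l2 => [|q l2] /=; rewrite big_cons.
rewrite big_cons -!mulrA; congr (_ * (_ * _)).
by case: l2 => [|q l2] /=; rewrite big_cons.
Qed.

(** * Approximating extended points by real points *)

(** The real points approaching an extended point. A real point gets its
    principal filter, so that the three kinds of points can be treated alike. *)
Definition xnbhs (R : realType) (u : xpoint R) : set_system R :=
  match u with
  | Lft t => t^'-
  | Pt t => globally [set t]
  | Rgt t => t^'+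
  end.

#[global] Instance xnbhs_proper (R : realType) (u : xpoint R) :
  ProperFilter (xnbhs u).
Proof.
case: u => t /=; try exact _.
by apply: (globally_properfilter (a := t)).
Qed.

Lemma xext_cvg (R : realType) (a b : R) (f : R -> R) (u : xpoint R) :
  regulated a b f -> xitv a b u -> f x @[x --> xnbhs u] --> xext f u.
Proof.
move=> [fl fr]; case: u => t /= tab; [exact: fl| |exact: fr].
by move=> A /nbhs_singleton At y /= ->.
Qed.

Lemma near_xlt_left (R : realType) (u v : xpoint R) :
  xlt u v -> \forall y \near xnbhs v, xlt u (Pt y).
Proof.
case: v => t /= uv.
- have ut : xbase u < t by move: uv; rewrite /xlt /= ltn0 andbF orbF.
  by apply: filterS (nbhs_left_gt ut) => y yt; apply: xlt_ltbase.
- by move=> y /= ->.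
- by apply: filterS (nbhs_right_gt t) => y ty; apply: xlt_ltbase;
    exact: le_lt_trans (xlt_baseW uv) ty.
Qed.

Lemma near_xlt_right (R : realType) (u v : xpoint R) :
  xlt u v -> \forall y \near xnbhs u, xlt (Pt y) v.
Proof.
case: u => t /= uv.
- by apply: filterS (nbhs_left_lt t) => y ty; apply: xlt_ltbase;
    exact: lt_le_trans ty (xlt_baseW uv).
- by move=> y /= ->.
- have tv : t < xbase v.
    by move: uv; rewrite /xlt /=; case: v => x; rewrite /= ?andbF ?orbF.
  by apply: filterS (nbhs_right_lt tv) => y yt; apply: xlt_ltbase.
Qed.

Lemma chain_prod_cvg (R : realType) (a b : R) (f : R -> R)
    (u v p : xpoint R) l1 l2 : regulated a b f -> xitv a b p ->
  chain_prod (xext f) u v (l1 ++ Pt y :: l2) @[y --> xnbhs p] -->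
  chain_prod (xext f) u v (l1 ++ p :: l2).
Proof.
move=> fab pab; have fp := xext_cvg fab pab.
have [A [B [_ AB]]] := chain_prod_insert (xext f) u v l1 l2.
rewrite AB; under eq_fun do rewrite AB.
apply: cvgM; last exact: cvg_cst.
apply: cvgM; first exact: cvg_cst.
apply: cvgM; apply: cvgD; try exact: cvg_cst.
  by apply: cvgB => //; exact: cvg_cst.
by apply: cvgB => //; exact: cvg_cst.
Qed.

(** A bound valid for chains of real points passes to all chains: the points
    of the chain are replaced one after the other by nearby real points,
    and the bound is kept in the limit. *)
Lemma chain_prod_close (R : realType) (a b : R) (f : R -> R) (u v : xpoint R)
    (s0 : seq R) (c d : R) : a < b -> regulated a b f ->
  xitv a b u -> xitv a b v ->
  (forall s, chain u v (map (@Pt R) s) -> covers s0 u v (map (@Pt R) s) ->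
     `|chain_prod (xext f) u v (map (@Pt R) s) - c| <= d) ->
  forall l, chain u v l -> covers s0 u v l ->
     `|chain_prod (xext f) u v l - c| <= d.
Proof.
move=> ab fab uab vab H l; rewrite -[l]/(map (@Pt R) [::] ++ l).
elim: l [::] => [s|p l IH s]; first by rewrite cats0; exact: H.
move=> Cl cl; move: (Cl); rewrite chain_cat => /andP[Csp Cpl].
have pab : xitv a b p :=
  xitv_between ab uab vab (chain_xlt Csp) (chain_xlt Cpl).
have := @chain_prod_cvg _ _ _ _ u v _ (map (@Pt R) s) l fab pab.
move=> /cvgB/(_ (cvg_cst c))/cvg_norm.
move=> /cvgr_to_le; apply.
have near1 : \forall y \near xnbhs p, chain u (Pt y) (map (@Pt R) s).
  move: Csp; rewrite /chain rcons_path => /andP[us /near_xlt_left].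
  by apply: filterS => y; rewrite rcons_path us.
have near2 : \forall y \near xnbhs p, chain (Pt y) v l.
  move: Cpl; rewrite /chain.
  case: (rcons l v) => [_|q r /= /andP[/near_xlt_right pq qr]].
    exact: nearW.
  by apply: filterS pq => y ->.
have near3 : \forall y \near xnbhs p,
    {subset reals (p :: l) <= reals (Pt y :: l)}.
  case: (p) => [t|t|t]; [apply: nearW|by move=> y /= ->|apply: nearW];
    by move=> y x /= xl; rewrite inE xl orbT.
near=> y; rewrite fctE.
rewrite -cat_rcons -map_rcons; apply: IH.
  by rewrite map_rcons cat_rcons chain_cat; apply/andP; split; near: y.
move=> x xs0 ux xv; have := cl x xs0 ux xv.
rewrite map_rcons cat_rcons !reals_cat !mem_cat => /orP[->//|xl].
by apply/orP; right; move: x xl {xs0 ux xv}; near: y.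
Unshelve. all: by end_near.
Qed.

(** * Product integrals with a variable endpoint *)

(** Relative closeness bounds all values by twice that of a single one, which
    turns the relative Cauchy condition into the usual one. *)
Lemma relatively_cauchy_cvg (R : realType) (T : Type) (F : set_system T)
    (FF : ProperFilter F) (X : T -> R) :
  (forall e, 0 < e -> exists2 A, F A &
     forall x y, A x -> A y -> X x != 0 /\ `|X y - X x| <= e * `|X x|) ->
  cvg (X x @[x --> F]).
Proof.
move=> H; apply: cauchy_cvg; apply: cauchy_exP => eps eps0.
have [A0 FA0 HA0] := H 1 ltr01.
have [x0 A0x0] := filter_ex FA0.
set M := 2 * `|X x0|.
have M0 : 0 < M by rewrite mulr_gt0// normr_gt0; case: (HA0 _ _ A0x0 A0x0).
have XM x : A0 x -> `|X x| <= M.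
  move=> A0x; have [_] := HA0 _ _ A0x0 A0x; rewrite mul1r /M => h.
  have := ler_normD (X x - X x0) (X x0); rewrite subrK; lra.
have e0 : 0 < eps / (2 * M) by rewrite divr_gt0// mulr_gt0.
have [A1 FA1 HA1] := H _ e0.
have [x [A0x A1x]] := filter_ex (filterI FA0 FA1).
exists (X x); rewrite nbhs_filterE /=; apply: (filterS (P := A1)) FA1 => y A1y.
rewrite /ball /= distrC; have [_ h] := HA1 _ _ A1x A1y.
apply: le_lt_trans h _.
apply: (@le_lt_trans _ _ (eps / (2 * M) * M)).
  by rewrite ler_wpM2l ?XM// ltW.
by rewrite invfM -!mulrA mulVf ?gt_eqF// mulr1; lra.
Qed.

Lemma xpartitionE (R : realType) (a b : R) (u v : xpoint R) (s : seq R) :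
  a < b -> xitv a b u -> xitv a b v ->
  xpartition a b u v s <-> chain u v (map (@Pt R) s).
Proof.
move=> ab uab vab; split => [[]//|C]; split => //.
apply/allP => x xs; move: C; rewrite chain_Pt => /and3P[_ _ /allP/(_ _ xs)].
by move=> /andP[ux xv]; exact: (xitv_between ab uab vab ux xv).
Qed.

Lemma near_refinement (R : realType) (a b : R) (u v : xpoint R) (s0 : seq R)
    (Q : seq R -> Prop) : a < b -> xitv a b u -> xitv a b v -> xlt u v ->
  (forall s, chain u v (map (@Pt R) s) -> covers s0 u v (map (@Pt R) s) ->
     Q s) ->
  \forall s \near refinement a b u v, Q s.
Proof.
move=> ab uab vab uv H; exists (between s0 u v).
  by apply/xpartitionE => //; exact: chain_between.
move=> s [/xpartitionE-/(_ ab uab vab) C sub]; apply: H => // x xs0 ux xv.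
by rewrite reals_Pt sub// mem_between xs0 ux.
Qed.

(** The common refinement of two partitions is the sorted union of their
    points. *)
Lemma refinement_proper (R : realType) (a b : R) (u v : xpoint R) :
  a < b -> xitv a b u -> xitv a b v -> xlt u v ->
  ProperFilter (refinement a b u v).
Proof.
move=> ab uab vab uv.
have bP s : xpartition a b u v (between s u v).
  by apply/xpartitionE => //; exact: chain_between.
apply: filter_from_proper; last by move=> s ps; exists s; split.
apply: filter_from_filter; first by exists (between [::] u v); exact: bP.
move=> s t ps pt; exists (between (s ++ t) u v) => // r [pr sub].
have bounds x : x \in s ++ t -> xlt u (Pt x) && xlt (Pt x) v.
  rewrite mem_cat => /orP[].
    move/xpartitionE: ps => /(_ ab uab vab).
    by rewrite chain_Pt => /and3P[_ _ /allP]; apply.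
  move/xpartitionE: pt => /(_ ab uab vab).
  by rewrite chain_Pt => /and3P[_ _ /allP]; apply.
have subr x : x \in s ++ t -> x \in r.
  by move=> xst; apply: sub; rewrite mem_between xst bounds.
by split; split=> // x xst; apply: subr; rewrite mem_cat xst ?orbT.
Qed.

Lemma prod_integralaa (R : realType) (a b : R) (f : R -> R) (u : xpoint R) :
  prod_integral a b f u u = 1.
Proof. by rewrite /prod_integral; case: asboolP. Qed.

Lemma prod_integral_lim (R : realType) (a b : R) (f : R -> R)
    (u v : xpoint R) : xlt u v -> prod_integral a b f u v =
  lim (xprod f u v s @[s --> refinement a b u v]).
Proof.
by move=> uv; rewrite /prod_integral; case: asboolP => // E;
  rewrite E xltxx in uv.
Qed.

Lemma prod_integrable_cvg (R : realType) (a b : R) (f : R -> R)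
    (u v : xpoint R) : xlt u v -> prod_integrable a b f u v ->
  xprod f u v s @[s --> refinement a b u v] --> prod_integral a b f u v.
Proof.
by move=> uv [E|c]; [rewrite E xltxx in uv|rewrite prod_integral_lim].
Qed.

(** Complete two chains from [a] to [u] by the same chain from [u] to [b],
    whose product is called [C] below. Both completed products are within [d]
    of the non-zero integral [P], so [C] is not zero and can be cancelled from
    the relative estimate. As [d] depends on [P] and [e] only, [s0] does not
    depend on [u]. *)
Lemma chain_prods_relatively_cauchy (R : realType) (a b : R) (f : R -> R) :
  a < b -> regulated a b f -> prod_integrable a b f (Pt a) (Pt b) ->
  prod_integral a b f (Pt a) (Pt b) != 0 ->
  forall e, 0 < e -> exists s0, forall u, xitv a b u -> xlt (Pt a) u ->
  forall l l', chain (Pt a) u l -> covers s0 (Pt a) u l ->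
    chain (Pt a) u l' -> covers s0 (Pt a) u l' ->
  chain_prod (xext f) (Pt a) u l != 0 /\
  `|chain_prod (xext f) (Pt a) u l' - chain_prod (xext f) (Pt a) u l|
     <= e * `|chain_prod (xext f) (Pt a) u l|.
Proof.
move=> ab fab hcvg; set P := prod_integral _ _ _ _ _ => P0 e e0.
have xab : xlt (Pt a) (Pt b) by rewrite xlt_PtE.
have aab : xitv a b (Pt a) by rewrite /= lexx ltW.
have bab : xitv a b (Pt b) by rewrite /= lexx ltW.
(* [d] solves 2 d = e (|P| - d): completed products are at distance at most 2 d
   from each other and of absolute value at least |P| - d. *)
pose d := e * `|P| / (2 + e).
have normP : 0 < `|P| by rewrite normr_gt0.
have d0 : 0 < d by rewrite divr_gt0 ?mulr_gt0// addr_gt0.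
have dE : 2 * d + e * d = e * `|P|.
  by rewrite -mulrDl /d mulrCA divff ?mulr1// gt_eqF// addr_gt0.
have := prod_integrable_cvg xab hcvg.
have := refinement_proper ab aab bab xab => FF.
move=> /cvgrPdist_le/(_ _ d0)[s0 ps0 Hs0].
exists s0 => u uab au.
have full l : chain (Pt a) (Pt b) l -> covers s0 (Pt a) (Pt b) l ->
    `|chain_prod (xext f) (Pt a) (Pt b) l - P| <= d.
  apply: (chain_prod_close ab fab aab bab) => s Cs cs.
  rewrite distrC; apply: Hs0; split.
    exact/xpartitionE.
  move=> x xs0; move/xpartitionE: ps0 => /(_ ab aab bab).
  rewrite chain_Pt => /and3P[_ _ /allP/(_ _ xs0)/andP[ax xb]].
  by have := cs _ xs0 ax xb; rewrite reals_Pt.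
have [C HC] : exists C, forall l, chain (Pt a) u l -> covers s0 (Pt a) u l ->
    `|chain_prod (xext f) (Pt a) u l * C - P| <= d.
  have [_ [->|ub]] := (xitvE u ab).1 uab.
    by exists 1 => l; rewrite mulr1; exact: full.
  exists (chain_prod (xext f) u (Pt b)
    (map (@Pt R) (between s0 u (Pt b)))) => l Cl cl.
  rewrite -chain_prod_cat; apply: full.
    by rewrite chain_cat Cl chain_between.
  by apply: covers_cat => //; exact: covers_between.
move=> l l' Cl cl Cl' cl'.
have h := HC _ Cl cl; have h' := HC _ Cl' cl'.
set X := chain_prod _ _ _ l in h *; set X' := chain_prod _ _ _ l' in h' *.
have XC : `|P| - d <= `|X * C|.
  by have := ler_normB (X * C) (X * C - P); rewrite opprB addrC subrK; lra.
have dP : d < `|P|.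
  rewrite -(ltr_pM2l e0) -dE ltrDr; lra.
have XC0 : X * C != 0 by rewrite -normr_gt0; lra.
have C0 : C != 0 by apply: contra_neq XC0 => ->; rewrite mulr0.
split; first by apply: contra_neq XC0 => ->; rewrite mul0r.
rewrite -(ler_pM2r (x := `|C|)) ?normr_gt0// -mulrA -!normrM mulrBl.
have -> : X' * C - X * C = (X' * C - P) - (X * C - P) by lra.
apply: le_trans (ler_normB _ _) _.
apply: (@le_trans _ _ (e * (`|P| - d))); first lra.
by rewrite ler_pM2l.
Qed.

(** The finite set [s0] is chosen before the endpoints, which may be symbols
    t- and t+, and the error is relative. The jump formulas, the regularity of
    [G] and the limits of products along nested partitions all come from this
    property. *)
Definition uniformly_approximates (R : realType) (a b : R)
    (F G : xpoint R -> R) : Prop :=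
  forall e, 0 < e -> exists s0, forall u v l, xitv a b u -> xitv a b v ->
    chain u v l -> covers s0 u v l ->
    `|chain_prod F u v l - G v / G u| <= e * `|G v / G u|.

(** A fine chain from [u] to [v] is preceded by fine chains from [a] to [u]; as
    the latter are refined, the product from [a] to [v] is X(u, v, l) times a
    factor tending to [G u]. *)
Lemma prod_integral_approximates (R : realType) (a b : R) (f : R -> R) :
  a < b -> regulated a b f -> prod_integrable a b f (Pt a) (Pt b) ->
  prod_integral a b f (Pt a) (Pt b) != 0 ->
  (forall u, xitv a b u -> prod_integral a b f (Pt a) u != 0) /\
  uniformly_approximates a b (xext f) (prod_integral a b f (Pt a)).
Proof.
move=> ab fab hcvg hnz.
have cauchy := chain_prods_relatively_cauchy ab fab hcvg hnz.
set G := prod_integral a b f (Pt a).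
have aab : xitv a b (Pt a) by rewrite /= lexx ltW.
have Gcvg u : xitv a b u -> xlt (Pt a) u ->
    xprod f (Pt a) u s @[s --> refinement a b (Pt a) u] --> G u.
  move=> uab au; have FF := refinement_proper ab aab uab au.
  apply: prod_integrable_cvg => //; right; apply: relatively_cauchy_cvg.
  move=> e /cauchy[s0 H].
  exists [set s | chain (Pt a) u (map (@Pt R) s) /\
                  covers s0 (Pt a) u (map (@Pt R) s)].
    by apply: (near_refinement (s0 := s0)) => // s Cs cs; split.
  by move=> s s' [? ?] [? ?]; exact: H.
have Grel e : 0 < e -> exists s0, forall u l, xitv a b u -> chain (Pt a) u l ->
    covers s0 (Pt a) u l -> chain_prod (xext f) (Pt a) u l != 0 /\
    `|G u - chain_prod (xext f) (Pt a) u l|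
      <= e * `|chain_prod (xext f) (Pt a) u l|.
  move=> /cauchy[s0 H]; exists s0 => u l uab Cl cl.
  have au := chain_xlt Cl; have FF := refinement_proper ab aab uab au.
  split; first by case: (H _ uab au _ _ Cl cl Cl cl).
  have /cvgB/(_ (cvg_cst (chain_prod (xext f) (Pt a) u l)))/cvg_norm :=
    Gcvg _ uab au.
  move=> /cvgr_to_le; apply.
  by apply: (near_refinement (s0 := s0)) => // s Cs cs;
    case: (H u uab au l _ Cl cl Cs cs).
have G0 u : xitv a b u -> G u != 0.
  move=> uab; have [[->|au] _] := (xitvE u ab).1 uab.
    by rewrite /G prod_integralaa oner_neq0.
  have [s0 H] := Grel (2^-1) ltac:(by rewrite invr_gt0).
  have [X0] := H u (map (@Pt R) (between s0 (Pt a) u)) uab (chain_between _ au)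
    (covers_between (fun x => id)).
  apply: contraTneq => ->; rewrite sub0r normrN -ltNge.
  by rewrite -normr_gt0 in X0; lra.
split=> // e e0.
(* The estimate is first obtained relative to X; passing to one relative to
   [G v / G u] costs a factor 2 as soon as e1 <= 1/2. *)
pose e1 := Num.min (2^-1) (e / 2).
have e10 : 0 < e1 by rewrite lt_min invr_gt0 ltr0n divr_gt0.
have [s0 H] := Grel _ e10; exists s0 => u v l uab vab Cl cl.
set X := chain_prod _ _ _ _.
have GuX : `|G v - G u * X| <= e1 * `|G u * X|.
  have [[E|au] _] := (xitvE u ab).1 uab.
    rewrite {1 2}E /G prod_integralaa !mul1r -/G /X E.
    by rewrite E in Cl cl; case: (H v l vab Cl cl).
  have FF := refinement_proper ab aab uab au.
  have cX : xprod f (Pt a) u s * X @[s --> refinement a b (Pt a) u]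
      --> G u * X by apply: cvgMr_tmp; exact: Gcvg.
  rewrite -subr_le0.
  have : `|G v - xprod f (Pt a) u s * X| - e1 * `|xprod f (Pt a) u s * X|
      @[s --> refinement a b (Pt a) u] --> `|G v - G u * X| - e1 * `|G u * X|.
    apply: cvgB; last by apply: cvgMl_tmp; exact: cvg_norm.
    by apply: cvg_norm; apply: cvgB => //; exact: cvg_cst.
  move=> /cvgr_to_le; apply.
  apply: (near_refinement (s0 := s0)) => // s Cs cs.
  rewrite subr_le0 /xprod -/(chain_prod (xext f) _ _ _) -chain_prod_cat.
  by apply: (proj2 (H v _ vab _ _)); [rewrite chain_cat Cs|exact: covers_cat].
have Gu : 0 < `|G u| by rewrite normr_gt0 G0.
have {GuX} : `|G v / G u - X| <= e1 * `|X|.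
  rewrite -(ler_pM2l Gu) mulrCA -!normrM mulrBr mulrC mulfVK ?G0//.
set L := G v / G u => h.
have := ler_normD (X - L) L; rewrite subrK distrC => h2.
have h3 : e1 <= 2^-1 by rewrite ge_min lexx.
have h4 : e1 <= e / 2 by rewrite ge_min lexx orbT.
have h5 : `|X| <= 2 * `|L|.
  have : e1 * `|X| <= 2^-1 * `|X| by rewrite ler_wpM2r.
  lra.
apply: le_trans h _.
apply: (@le_trans _ _ (e / 2 * (2 * `|L|))); last by rewrite mulrA mulfVK.
by rewrite ler_pM// ltW.
Qed.

(** * Consequences of uniform approximation *)

(** Whatever the endpoints, refinements eventually cover [s0], so their products
    are within any prescribed error of [G v / G u]. *)
Lemma prod_integral_ratio (R : realType) (a b : R) (f : R -> R)
    (G : xpoint R -> R) (u v : xpoint R) : a < b ->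
  uniformly_approximates a b (xext f) G ->
  xitv a b u -> xitv a b v -> xlt u v ->
  prod_integrable a b f u v /\ prod_integral a b f u v = G v / G u.
Proof.
move=> ab app uab vab uv; have FF := refinement_proper ab uab vab uv.
have cX : xprod f u v s @[s --> refinement a b u v] --> G v / G u.
  apply/cvgrPdist_le => e e0.
  have L0 : 0 < `|G v / G u| + 1 by rewrite ltr_wpDl.
  have [s0 H] := app _ (divr_gt0 e0 L0).
  apply: (near_refinement (s0 := s0)) => // s Cs cs.
  rewrite distrC; apply: le_trans (H u v _ uab vab Cs cs) _.
  by rewrite mulrAC -mulrA ler_piMr ?(ltW e0)// ler_pdivrMr// mul1r lerDl.
split; first by right; apply/cvg_ex; exists (G v / G u).
by rewrite prod_integral_lim//; apply: cvg_lim.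
Qed.

(** The bound is relative to [q], which is itself bounded because [h] is. It is
    used with [q] a quotient of values of [G] and [h] the single factor of a
    chain without interior points. *)
Lemma relatively_close_cvg1 (R : realType) (T : Type) (F : set_system T)
    (FF : ProperFilter F) (h q : T -> R) : h x @[x --> F] --> (1 : R) ->
  (forall e, 0 < e -> \forall x \near F, `|h x - q x| <= e * `|q x|) ->
  q x @[x --> F] --> (1 : R).
Proof.
move=> h1 hq; apply/cvgrPdist_le => e e0.
(* From d <= 1/2 follow |h| <= 2 and |q| <= 4, hence |1 - q| <= d + 4 d < e. *)
pose d := Num.min (2^-1) (e / 8).
have d0 : 0 < d by rewrite lt_min invr_gt0 ltr0n divr_gt0.
have d2 : d <= 2^-1 by rewrite ge_min lexx.
have de : d <= e / 8 by rewrite ge_min lexx orbT.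
near=> x.
have hx : `|1 - h x| <= d.
  by near: x; move/cvgrPdist_le : h1; apply.
have hqx : `|h x - q x| <= d * `|q x| by near: x; exact: hq.
have h2 : `|h x| <= 2.
  have := ler_normB 1 (1 - h x); rewrite opprB addrC subrK normr1; lra.
have q4 : `|q x| <= 4.
  have := ler_normB (h x) (h x - q x); rewrite opprB addrC subrK.
  have : d * `|q x| <= 2^-1 * `|q x| by rewrite ler_wpM2r.
  lra.
have dq : d * `|q x| <= d * 4 by rewrite ler_pM2l.
have := ler_normD (1 - h x) (h x - q x); rewrite addrA subrK; lra.
Unshelve. all: by end_near.
Qed.

Lemma near_forall_mem (R : realType) (T : Type) (F : set_system T)
    (FF : Filter F) (s0 : seq R) (P : R -> T -> Prop) :
  (forall x, \forall y \near F, P x y) ->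
  \forall y \near F, forall x, x \in s0 -> P x y.
Proof.
move=> H; elim: s0 => [|z s0 IH]; first exact: nearW.
near=> y => x; rewrite inE => /orP[/eqP->|]; first by near: y.
by move: x; near: y.
Unshelve. all: by end_near.
Qed.

(** Close to [s] on the right there is no point of [s0], so the one-factor chain
    from s+ to x approximates G(x) / G(s+); that factor tends to 1. *)
Lemma approximates_right_cvg (R : realType) (a b : R) (f : R -> R)
    (G : xpoint R -> R) (s : R) : a < b -> regulated a b f ->
  (forall u, xitv a b u -> G u != 0) ->
  uniformly_approximates a b (xext f) G ->
  a <= s < b -> G (Pt x) @[x --> s^'+] --> G (Rgt s).
Proof.
move=> ab fab G0 app sab; have pab : xitv a b (Rgt s) := sab.
have /andP[as_ sb] := sab.
have Gs := G0 _ pab.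
have q1 : G (Pt x) / G (Rgt s) @[x --> s^'+] --> (1 : R).
  apply: (@relatively_close_cvg1 _ _ _ _
    (fun x => 1 + (f x - xext f (Rgt s)))).
    rewrite -[X in _ --> X]addr0; apply: cvgD; first exact: cvg_cst.
    rewrite -(subrr (xext f (Rgt s))); apply: cvgB; last exact: cvg_cst.
    exact: (xext_cvg fab pab).
  move=> e e0; have [s0 H] := app _ e0.
  near=> x.
  have sx : s < x by near: x; exact: nbhs_right_gt.
  have xb : x < b by near: x; exact: nbhs_right_lt.
  have := H (Rgt s) (Pt x) [::] pab.
  rewrite /chain_prod /= big_seq1; apply.
  - by rewrite /= (le_trans as_ (ltW sx)) ltW.
  - by rewrite /chain /= /xlt /= sx.
  - move=> z zs0; have : z \in s0 -> ~~ ((s < z) && (z < x)).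
      move: z {zs0}; near: x; apply: near_forall_mem => z.
      have [sz|zs] := ltP s z; last exact: nearW.
      by apply: filterS (nbhs_right_le sz) => y; rewrite -leNgt.
    move=> /(_ zs0); rewrite xlt_PtE /xlt /= andbF orbF.
    by case: (s < z) => //= /negbTE ->.
have := cvgMr_tmp (b := G (Rgt s)) q1.
by rewrite mul1r; under eq_fun do rewrite mulfVK//; apply.
Unshelve. all: by end_near.
Qed.

Lemma approximates_left_cvg (R : realType) (a b : R) (f : R -> R)
    (G : xpoint R -> R) (t : R) : a < b -> regulated a b f ->
  (forall u, xitv a b u -> G u != 0) ->
  uniformly_approximates a b (xext f) G ->
  a < t <= b -> G (Pt x) @[x --> t^'-] --> G (Lft t).
Proof.
move=> ab fab G0 app tab; have pab : xitv a b (Lft t) := tab.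
have /andP[at_ tb] := tab.
have Gt := G0 _ pab.
have q1 : G (Lft t) / G (Pt x) @[x --> t^'-] --> (1 : R).
  apply: (@relatively_close_cvg1 _ _ _ _
    (fun x => 1 + (xext f (Lft t) - f x))).
    rewrite -[X in _ --> X]addr0; apply: cvgD; first exact: cvg_cst.
    rewrite -(subrr (xext f (Lft t))); apply: cvgB; first exact: cvg_cst.
    exact: (xext_cvg fab pab).
  move=> e e0; have [s0 H] := app _ e0.
  near=> x.
  have xt : x < t by near: x; exact: nbhs_left_lt.
  have ax : a < x by near: x; exact: nbhs_left_gt.
  have := H (Pt x) (Lft t) [::] _ pab.
  rewrite /chain_prod /= big_seq1; apply.
  - by rewrite /= (le_trans (ltW xt) tb) ltW.
  - by rewrite /chain /= /xlt /= xt.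
  - move=> z zs0; have : z \in s0 -> ~~ ((x < z) && (z < t)).
      move: z {zs0}; near: x; apply: near_forall_mem => z.
      have [zt|tz] := ltP z t; last by apply: nearW => y; rewrite andbF.
      by apply: filterS (nbhs_left_ge zt) => y; rewrite andbT -leNgt.
    move=> /(_ zs0); rewrite xlt_PtE /xlt /= andbF orbF.
    by case: (x < z) => //= /negbTE ->.
have := cvgMl_tmp (a := G (Lft t)) (cvgV (oner_neq0 _) q1).
rewrite invr1 mulr1 => /(_ _) H; have {}H := H _.
apply: cvg_trans (H _); apply: near_eq_cvg; near=> x.
by rewrite /= invf_div mulrCA divff// mulr1.
Unshelve. all: by end_near.
Qed.

Lemma approximates_eq (R : realType) (x L : R) :
  (forall e, 0 < e -> `|x - L| <= e * `|L|) -> L = x.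
Proof.
move=> H; apply/esym/eqP; rewrite -subr_eq0 -normr_le0 leNgt.
apply/negP => d0.
have L0 : 0 < `|L|.
  by rewrite lt_neqAle normr_ge0 andbT; apply/eqP => E;
    have := H 1 ltr01; rewrite -E mulr0; lra.
(* With this e the hypothesis says that |x - L| is at most half of itself. *)
have e0 : 0 < `|x - L| / (2 * `|L|) by rewrite divr_gt0// mulr_gt0.
have := H _ e0; rewrite invfM -!mulrA mulVf ?gt_eqF// mulr1; lra.
Qed.

(** No real point lies between s and s+, so the one-factor chain covers every
    [s0] and its product equals the quotient of [G] exactly. *)
Lemma approximates_right_jump (R : realType) (a b : R) (f : R -> R)
    (G : xpoint R -> R) (s : R) :
  uniformly_approximates a b (xext f) G ->
  a <= s < b -> G (Rgt s) / G (Pt s) = 1 + right_jump f s.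
Proof.
move=> app sab; apply: approximates_eq => e /app[s0 H].
have := H (Pt s) (Rgt s) [::]; rewrite /chain_prod /= big_seq1; apply => //.
- by move: sab => /andP[-> /ltW].
- by rewrite /chain /= /xlt /= eqxx orbT.
- by move=> x _; rewrite /xlt /= ltnn andbF orbF; case: ltgtP.
Qed.

Lemma approximates_left_jump (R : realType) (a b : R) (f : R -> R)
    (G : xpoint R -> R) (t : R) :
  uniformly_approximates a b (xext f) G ->
  a < t <= b -> G (Pt t) / G (Lft t) = 1 + left_jump f t.
Proof.
move=> app tab; apply: approximates_eq => e /app[s0 H].
have := H (Lft t) (Pt t) [::]; rewrite /chain_prod /= big_seq1; apply => //.
- by move: tab => /andP[/ltW ->].
- by rewrite /chain /= /xlt /= eqxx orbT.
- by move=> x _; rewrite /xlt /= ltnn andbF orbF; case: ltgtP.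
Qed.

(** Around each point of [a, b], |g| is bounded below by a positive constant on
    the left, at the point and on the right; compactness makes it uniform. *)
Lemma inf_norm_gt0 (R : realType) (a b : R) (g : R -> R) : a < b ->
  regulated a b g -> (forall u, xitv a b u -> xext g u != 0) ->
  0 < inf [set `|g t| | t in `[a, b]].
Proof.
move=> ab gab g0.
have loc u : a <= xbase u <= b -> exists2 c, 0 < c &
    \forall y \near xnbhs u, a <= y <= b -> c <= `|g y|.
  move=> ub; have [uab|nuab] := pselect (xitv a b u).
    have gu : 0 < `|xext g u| by rewrite normr_gt0 g0.
    exists (`|xext g u| / 2); first by rewrite divr_gt0.
    have /cvgr_norm_gt H := xext_cvg gab uab.
    near=> y => _; apply: ltW.
    by near: y; apply: H; lra.
  (* Left are a- and b+, whose neighbourhoods lie outside [a, b]. *)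
  exists 1 => //; case: u ub nuab => t /= /andP[at_ tb] nuab.
  - have ta : t <= a by rewrite leNgt; apply/negP => h; apply: nuab; rewrite h.
    apply: filterS (nbhs_left_lt t) => y yt /andP[ay _].
    by have := lt_le_trans (le_lt_trans ay yt) ta; rewrite ltxx.
  - by exfalso; apply: nuab; rewrite at_.
  - have bt : b <= t.
      by rewrite leNgt; apply/negP => h; apply: nuab; rewrite at_.
    apply: filterS (nbhs_right_gt t) => y ty /andP[_ yb].
    by have := lt_le_trans (le_lt_trans bt ty) yb; rewrite ltxx.
have cov := (compact_near_coveringP _).1 (@segment_compact R a b).
have := cov _ (0 : R)^'+ (fun r x => a <= x <= b -> r <= `|g x|) _.
move=> H; have {}H : \forall r \near (0 : R)^'+,
    `[a, b] `<=` (fun x => a <= x <= b -> r <= `|g x|).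
  apply: H => x /=; rewrite in_itv /= => xab.
  have [c1 c10 H1] := loc (Lft x) xab.
  have [c2 c20 H2] := loc (Pt x) xab.
  have [c3 c30 H3] := loc (Rgt x) xab.
  pose c := Num.min c1 (Num.min c2 c3).
  have c0 : 0 < c by rewrite !lt_min c10 c20.
  exists ([set y | a <= y <= b -> c <= `|g y|], [set r | r <= c]).
    split; last by have := nbhs_right_le c0.
    move: H1 H3; rewrite /= /at_left /at_right !near_withinE => H1 H3.
    near=> y => yab; rewrite /c !ge_min.
    have [yx|xy|E] := ltgtP y x.
    - by apply/orP; left; move: yx yab; near: y.
    - by apply/orP; right; apply/orP; right; move: xy yab; near: y.
    - by rewrite H2 ?orbT.
  move=> [y r] [/= h rc] yab; exact: le_trans rc (h yab).
have [r [r0 Hr]] : exists r, 0 < r /\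
    `[a, b] `<=` (fun x => a <= x <= b -> r <= `|g x|).
  have := filter_ex (filterI (nbhs_right_gt (0 : R)) H).
  by move=> [r [r0 Hr]]; exists r.
apply: lt_le_trans r0 _; apply: lb_le_inf.
  by exists `|g a|; exists a => //; rewrite /= in_itv /= lexx ltW.
by move=> _ [t /= tab <-]; apply: Hr => //; move: tab; rewrite in_itv.
Unshelve. all: by end_near.
Qed.

(** * Products along nested partitions *)

Lemma eq_between (R : realType) (s0 s1 : seq R) (u v : xpoint R) :
  s0 =i s1 -> between s0 u v = between s1 u v.
Proof.
move=> s01; apply: lt_sorted_eq; try exact: between_sorted.
by move=> x; rewrite !mem_between s01.
Qed.

Lemma between_insert (R : realType) (s0 : seq R) (z : R) (u v : xpoint R) :
  z \notin s0 -> xlt u (Pt z) -> xlt (Pt z) v ->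
  between s0 u v = between s0 u (Pt z) ++ between s0 (Pt z) v /\
  between (z :: s0) u v = between s0 u (Pt z) ++ z :: between s0 (Pt z) v.
Proof.
move=> zs0 uz zv.
have zE x : x \in s0 -> xlt (Pt x) (Pt z) || xlt (Pt z) (Pt x).
  move=> xs0; rewrite !xlt_PtE -neq_lt; apply: contraNneq zs0 => <-.
  exact: xs0.
have sz : sorted <%R (between s0 u (Pt z) ++ z :: between s0 (Pt z) v).
  suff : chain u v
      (map (@Pt R) (between s0 u (Pt z) ++ z :: between s0 (Pt z) v)).
    by rewrite chain_Pt => /and3P[].
  by rewrite map_cat /= chain_cat !chain_between.
have memE x : x \in s0 -> xlt u (Pt x) && xlt (Pt x) v =
    (xlt u (Pt x) && xlt (Pt x) (Pt z)) || (xlt (Pt z) (Pt x) && xlt (Pt x) v).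
  move=> /zE /orP[] h; rewrite h ?andbT /=.
    have hv := xlt_trans h zv.
    rewrite hv andbT; case: (xlt u (Pt x)) => //=.
    by apply/esym/negbTE/negP => /andP[h' _];
      have := xlt_trans h h'; rewrite xltxx.
  rewrite (xlt_trans uz h) /=.
  case: (xlt (Pt x) v); rewrite ?orbT // orbF.
  by apply/esym/negbTE/negP => h'; have := xlt_trans h h'; rewrite xltxx.
split; apply: lt_sorted_eq => //; try exact: between_sorted.
- apply: subseq_sorted sz; first exact: lt_trans.
  by apply: cat_subseq => //; exact: subseq_cons.
- move=> x; rewrite mem_cat !mem_between.
  by case xs0 : (x \in s0) => //=; exact: memE.
- move=> x; rewrite mem_cat inE !mem_between inE.
  have [->|_] /= := eqVneq x z; first by rewrite uz zv orbT.
  by case xs0 : (x \in s0) => //=; exact: memE.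
Qed.

Lemma le_last_sorted (R : realType) (x0 x : R) (l : seq R) :
  sorted <%R l -> x \in l -> x <= last x0 l.
Proof.
case/lastP: l => // l y; rewrite sorted_pairwise; last exact: lt_trans.
rewrite pairwise_rcons last_rcons mem_rcons inE => /andP[/allP ly _].
by move=> /orP[/eqP->//|/ly/ltW].
Qed.

Lemma head_le_sorted (R : realType) (x0 x : R) (l : seq R) :
  sorted <%R l -> x \in l -> head x0 l <= x.
Proof.
case: l => // y l /= /order_path_min ly; rewrite inE => /orP[/eqP->//|xl].
by apply/ltW; move/allP: (ly lt_trans) => /(_ _ xl).
Qed.

Lemma Lambda_mono (R : realType) (a b : R) (lam : nat -> seq R) (m n : nat) :
  Lambda a b lam -> (m <= n)%N -> {subset lam m <= lam n}.
Proof.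
move=> [_ lamS _] /subnK <-; elim: (n - m)%N => // k IH x /IH.
by rewrite addSn; exact: lamS.
Qed.

Lemma Lambda_dense (R : realType) (a b : R) (lam : nat -> seq R) (x y : R) :
  Lambda a b lam -> a <= x -> x < y -> y <= b ->
  exists2 p, x < p < y & \forall m \near \oo, p \in lam m.
Proof.
move=> L ax xy yb; have [_ _ dense] := L.
(* The midpoint is a limit of partition points; those in ]x, y[ differ
   from a, the only one that the lists [lam m] leave out. *)
have [||p [[m +] ]] := dense ((x + y) / 2) _ `]x, y[%classic.
- by rewrite /= in_itv /=; apply/andP; split; lra.
- by apply: near_in_itvoo; rewrite in_itv /=; apply/andP; split; lra.
rewrite /= in_itv /= inE => pm pxy.
have pa : p != a by rewrite gt_eqF//; case/andP: pxy => /(le_lt_trans ax).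
exists p => //; exists m => // n /= mn.
by move: pm; rewrite (negbTE pa) => /(Lambda_mono L mn).
Qed.

(** The predecessor of [z] in the m-th partition, refined by the points of [K],
    tends to [z] from the left: by density some partition, hence all later ones,
    has a point in any given interval ending at [z]. *)
Lemma between_last_cvg (R : realType) (a b : R) (lam : nat -> seq R)
    (K : seq R) (s z : R) : Lambda a b lam -> a <= s -> s < z -> z <= b ->
  last s (between (lam m ++ K) (Pt s) (Pt z)) @[m --> \oo] --> z^'-.
Proof.
move=> L as_ sz zb A /nbhs_ballP[e /= e0 eA].
have sez : Num.max s (z - e) < z by rewrite gt_max sz /=; lra.
have ase : a <= Num.max s (z - e) by rewrite le_max as_.
have [p /andP[pl pz] plam] := Lambda_dense L ase sez zb.
move: pl; rewrite gt_max => /andP[sp ep].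
rewrite nbhs_filterE /=; apply: filterS plam => m pm; rewrite /preimage /=.
set l := between _ _ _.
have pl : p <= last s l.
  apply: le_last_sorted; first exact: between_sorted.
  by rewrite mem_between mem_cat pm !xlt_PtE sp.
have lz : last s l < z.
  have := mem_last s l; rewrite inE => /orP[/eqP->//|].
  by rewrite mem_between !xlt_PtE => /and3P[].
by apply: eA => //; rewrite /ball /= gtr0_norm; lra.
Qed.

Lemma between_head_cvg (R : realType) (a b : R) (lam : nat -> seq R)
    (K : seq R) (z t : R) : Lambda a b lam -> a <= z -> z < t -> t <= b ->
  head t (between (lam m ++ K) (Pt z) (Pt t)) @[m --> \oo] --> z^'+.
Proof.
move=> L az zt tb A /nbhs_ballP[e /= e0 eA].
have sez : z < Num.min t (z + e) by rewrite lt_min zt /=; lra.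
have ase : Num.min t (z + e) <= b by rewrite ge_min tb.
have [p /andP[zp pl] plam] := Lambda_dense L az sez ase.
move: pl; rewrite lt_min => /andP[pt pe].
rewrite nbhs_filterE /=; apply: filterS plam => m pm; rewrite /preimage /=.
set l := between _ _ _.
have pl : head t l <= p.
  apply: head_le_sorted; first exact: between_sorted.
  by rewrite mem_between mem_cat pm !xlt_PtE zp.
have lz : z < head t l.
  have : head t l \in t :: l by case: (l) => [|? ?]; rewrite !inE eqxx ?orbT.
  rewrite inE => /orP[/eqP->//|].
  by rewrite mem_between !xlt_PtE => /and3P[].
by apply: eA => //; rewrite /ball /= ltr0_norm; lra.
Qed.

(** The induction adds one point [z] at a time. If [z] is outside ]s, t[, or in
    [K] or in some partition, nothing changes for large m; otherwise one jump
    of [f] at [z] is zero and, D^- f and D^+ f being the left and right jumps,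
    1 + D^- f(z) + D^+ f(z) = (1 + D^- f(z)) (1 + D^+ f(z)),
    so the quotient of the factors before and after the insertion tends to 1.
    The sequence [r] relates the products without dividing by either of them,
    since they may vanish. *)
Lemma insertion_ratio_cvg (R : realType) (a b : R) (f : R -> R)
    (lam : nat -> seq R) (s t : R) : regulated a b f -> Lambda a b lam ->
  [set t | a < t < b /\ left_jump f t * right_jump f t != 0]
    `<=` partition_points a lam ->
  (forall z, a < z < b -> 1 + left_jump f z != 0 /\ 1 + right_jump f z != 0) ->
  a <= s -> s < t -> t <= b -> forall K : seq R,
  exists2 r : nat -> R, r m @[m --> \oo] --> (1 : R) &
  \forall m \near \oo, lprod lam f s t m =
    chain_prod (xext f) (Pt s) (Pt t)
      (map (@Pt R) (between (lam m ++ K) (Pt s) (Pt t))) * r m.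
Proof.
move=> fab L hjump jump0 as_ st tb; elim => [|z K [r r1 IH]].
  exists (fun=> 1); first exact: cvg_cst.
  apply: nearW => m; rewrite mulr1 cats0; congr chain_prod; congr map.
  apply: lt_sorted_eq; last 1 first.
  - by move=> x; rewrite mem_filter mem_between !xlt_PtE andbC.
  - apply: sorted_filter; first exact: lt_trans.
    by have [/(_ m)[/path_sorted]] := L.
  - exact: between_sorted.
have [szt|nszt] := boolP (s < z < t); last first.
  exists r => //; near=> m.
  have -> : between (lam m ++ z :: K) (Pt s) (Pt t) =
            between (lam m ++ K) (Pt s) (Pt t).
    apply: lt_sorted_eq; try exact: between_sorted.
    move=> x; rewrite !mem_between !mem_cat inE !xlt_PtE.
    by have [->|//] := eqVneq x z; rewrite (negbTE nszt) !andbF.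
  by near: m.
have [zK|zK] := boolP (z \in K).
  exists r => //; near=> m.
  rewrite (@eq_between _ _ (lam m ++ K)); first by near: m.
  by move=> x; rewrite !mem_cat inE; have [->|] := eqVneq x z;
    rewrite ?zK ?orbT.
have za : z != a by case/andP: szt => sz _; rewrite gt_eqF// (le_lt_trans as_).
have [[m0 zm0]|zlam] := pselect (partition_points a lam z).
  exists r => //; near=> m.
  rewrite (@eq_between _ _ (lam m ++ K)); first by near: m.
  have zm : z \in lam m.
    move: zm0; rewrite inE (negbTE za) /= => /(Lambda_mono L); apply.
    by near: m; exact: nbhs_infty_ge.
  by move=> x; rewrite !mem_cat inE; have [->|//] := eqVneq x z; rewrite zm.
case/andP: szt => sz zt.
have az : a < z := le_lt_trans as_ sz.
have zb : z < b := lt_le_trans zt tb.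
have zab : a < z < b by rewrite az.
have jz : left_jump f z * right_jump f z = 0.
  by apply/eqP; apply: contra_notT zlam => h; apply: hjump.
have [jl jr] := jump0 z zab.
(* The neighbours of [z]; [s] and [t] stand in when there is no point in
   between. *)
pose x m := last s (between (lam m ++ K) (Pt s) (Pt z)).
pose y m := head t (between (lam m ++ K) (Pt z) (Pt t)).
have fx : f (x m) @[m --> \oo] --> xext f (Lft z).
  apply: (cvg_comp _ _ (between_last_cvg _ L as_ sz (ltW zb))).
  by apply: (xext_cvg (u := Lft z) fab); rewrite /= az ltW.
have fy : f (y m) @[m --> \oo] --> xext f (Rgt z).
  apply: (cvg_comp _ _ (between_head_cvg _ L (ltW az) zt tb)).
  by apply: (xext_cvg (u := Rgt z) fab); rewrite /= zb ltW.
have cl : 1 + (f z - f (x m)) @[m --> \oo] --> 1 + left_jump f z.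
  by apply: cvgD; [exact: cvg_cst|apply: cvgB => //; exact: cvg_cst].
have cr : 1 + (f (y m) - f z) @[m --> \oo] --> 1 + right_jump f z.
  by apply: cvgD; [exact: cvg_cst|apply: cvgB => //; exact: cvg_cst].
have cm : 1 + (f (y m) - f (x m)) @[m --> \oo] -->
    (1 + left_jump f z) * (1 + right_jump f z).
  have -> : (1 + left_jump f z) * (1 + right_jump f z) =
      1 + (xext f (Rgt z) - xext f (Lft z)).
    rewrite mulrDl mul1r mulrDr mulr1 jz addr0 /left_jump /right_jump /=; lra.
  by apply: cvgD; [exact: cvg_cst|exact: cvgB].
have jlr : (1 + left_jump f z) * (1 + right_jump f z) != 0.
  by rewrite mulf_neq0.
pose d m := (1 + (f z - f (x m))) * (1 + (f (y m) - f z)).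
have dc : d m @[m --> \oo] --> (1 + left_jump f z) * (1 + right_jump f z).
  exact: cvgM.
exists (fun m => (1 + (f (y m) - f (x m))) / d m * r m).
  rewrite -[X in _ --> X]mulr1; apply: cvgM => //.
  by rewrite -[X in _ --> X](divff jlr); apply: cvgM cm _; exact: (cvgV jlr dc).
have d0 : \forall m \near \oo, d m != 0.
  by have /cvgr_neq0 := dc; apply.
near=> m.
have -> : lprod lam f s t m = chain_prod (xext f) (Pt s) (Pt t)
    (map (@Pt R) (between (lam m ++ K) (Pt s) (Pt t))) * r m by near: m.
have dm : d m != 0 by near: m.
have zmK : z \notin lam m ++ K.
  rewrite mem_cat negb_or zK andbT; apply/negP => zm; apply: zlam.
  by exists m; rewrite inE zm orbT.
rewrite mulrA; congr (_ * _).
rewrite (@eq_between _ (lam m ++ z :: K) (z :: (lam m ++ K))); last first.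
  by move=> w; rewrite inE !mem_cat inE orbCA.
have [||-> ->] := between_insert zmK (u := Pt s) (v := Pt t).
- by rewrite xlt_PtE.
- by rewrite xlt_PtE.
rewrite !map_cat /=.
set l1 := between _ _ _; set l2 := between _ _ _.
have [A [B [-> ->]]] := chain_prod_insert (xext f) (Pt s) (Pt t)
  (map (@Pt R) l1) (map (@Pt R) l2).
have -> : last (Pt s) (map (@Pt R) l1) = Pt (x m) by rewrite last_map.
have -> : head (Pt t) (map (@Pt R) l2) = Pt (y m).
  by rewrite /y -/l2; case: (l2).
by rewrite /= -/(d m); field.
Unshelve. all: by end_near.
Qed.

(** With the points of [s0] added, the products are within relative error [d] of
    the quotient of [G] for every m; their absence costs only a factor tending
    to 1. *)
Lemma lprod_cvg (R : realType) (a b : R) (f : R -> R)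
    (G : xpoint R -> R) (lam : nat -> seq R) (s t : R) : a < b ->
  regulated a b f -> Lambda a b lam ->
  [set t | a < t < b /\ left_jump f t * right_jump f t != 0]
    `<=` partition_points a lam ->
  (forall u, xitv a b u -> G u != 0) ->
  uniformly_approximates a b (xext f) G ->
  a <= s -> s < t -> t <= b ->
  lprod lam f s t m @[m --> \oo] --> G (Pt t) / G (Pt s).
Proof.
move=> ab fab L hjump G0 app as_ st tb.
have jump0 z : a < z < b ->
    1 + left_jump f z != 0 /\ 1 + right_jump f z != 0.
  move=> /andP[az zb].
  rewrite -(approximates_left_jump (t := z) app) ?az ?ltW//.
  rewrite -(approximates_right_jump (s := z) app) ?zb ?ltW//.
  by rewrite !mulf_neq0 ?invr_eq0 ?G0//= ?az ?zb ?ltW.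
set q := G (Pt t) / G (Pt s).
apply/cvgrPdist_le => e e0.
pose M := `|q| + 1.
have M0 : 0 < M by rewrite ltr_wpDl.
have qM : `|q| <= M by rewrite lerDl.
(* The product with [s0] added has absolute value at most 2 M; its distance to
   [q] contributes d M, the factor tending to 1 contributes 2 M d. *)
pose d := Num.min 1 (e / (3 * M)).
have d0 : 0 < d by rewrite lt_min ltr01 divr_gt0// mulr_gt0.
have d1 : d <= 1 by rewrite ge_min lexx.
have dM : d * M <= e / 3.
  apply: (@le_trans _ _ (e / (3 * M) * M)).
    by rewrite ler_pM2r// ge_min lexx orbT.
  by rewrite invfM -!mulrA mulVf ?gt_eqF// mulr1.
have [s0 H] := app _ d0.
have [r r1 Hr] := insertion_ratio_cvg fab L hjump jump0 as_ st tb s0.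
near=> m.
have -> : lprod lam f s t m = chain_prod (xext f) (Pt s) (Pt t)
    (map (@Pt R) (between (lam m ++ s0) (Pt s) (Pt t))) * r m by near: m.
set X := chain_prod _ _ _ _.
have rm : `|1 - r m| <= d by near: m; move/cvgrPdist_le: r1; apply.
have Xq : `|X - q| <= d * `|q|.
  apply: H.
  - by rewrite /= as_ (le_trans (ltW st)).
  - by rewrite /= tb (le_trans as_ (ltW st)).
  - by apply: chain_between; rewrite xlt_PtE.
  - by apply: covers_between => x; rewrite mem_cat => ->; rewrite orbT.
have dq : d * `|q| <= d * M by rewrite ler_pM2l.
have X2 : `|X| <= 2 * M.
  have := ler_normD (X - q) q; rewrite subrK.
  have : d * M <= 1 * M by rewrite ler_pM2r.
  lra.
have -> : q - X * r m = (q - X) + X * (1 - r m) by lra.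
apply: le_trans (ler_normD _ _) _; rewrite distrC normrM.
have : `|X| * `|1 - r m| <= 2 * M * d by rewrite ler_pM.
lra.
Unshelve. all: by end_near.
Qed.

(** * The product integral as a lambda-primitive *)

(** The one-sided limits of G along the real points are the values of [G] at the
    symbols t- and t+, so [xext] gives [G] back. *)
Lemma approximates_xext (R : realType) (a b : R) (f : R -> R)
    (G : xpoint R -> R) : a < b -> regulated a b f ->
  (forall u, xitv a b u -> G u != 0) ->
  uniformly_approximates a b (xext f) G ->
  regulated a b (fun t => G (Pt t)) /\
  (forall u, xitv a b u -> xext (fun t => G (Pt t)) u = G u).
Proof.
move=> ab fab G0 app.
have Gl t tab := @approximates_left_cvg _ _ _ _ _ t ab fab G0 app tab.
have Gr s sab := @approximates_right_cvg _ _ _ _ _ s ab fab G0 app sab.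
split.
  split=> [t tab|s sab]; apply/cvg_ex.
    by exists (G (Lft t)); exact: Gl.
  by exists (G (Rgt s)); exact: Gr.
by case=> t //= tab; [apply: cvg_lim => //; exact: Gl|
  apply: cvg_lim => //; exact: Gr].
Qed.

Lemma approximates_lprod_primitive (R : realType) (a b : R) (f : R -> R)
    (G : xpoint R -> R) (lam : nat -> seq R) : a < b ->
  regulated a b f -> Lambda a b lam ->
  [set t | a < t < b /\ left_jump f t * right_jump f t != 0]
    `<=` partition_points a lam ->
  G (Pt a) = 1 -> (forall u, xitv a b u -> G u != 0) ->
  uniformly_approximates a b (xext f) G ->
  lprod_primitive a b lam f (fun t => G (Pt t)).
Proof.
move=> ab fab L hjump Ga G0 app.
have [Greg Gext] := approximates_xext ab fab G0 app.
split => //.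
- by apply: inf_norm_gt0 => // u uab; rewrite Gext ?G0.
- by move=> s t as_ st tb; exact: (lprod_cvg ab fab L hjump G0 app).
- split => [t tab|s sab]; rewrite Gext//.
    exact: approximates_left_jump app tab.
  exact: approximates_right_jump app sab.
Qed.

Lemma eq_xext (R : realType) (a b : R) (G H : R -> R) (u : xpoint R) :
  a < b -> regulated a b H -> (forall t, a <= t <= b -> G t = H t) ->
  xitv a b u -> xext G u = xext H u.
Proof.
move=> ab Hreg GH uab; have Hu := xext_cvg Hreg uab.
have near_ab : \forall x \near xnbhs u, a <= x <= b.
  case: u uab {Hu} => t /= /andP[at_ tb]; last 2 first.
  - by move=> x /= ->; rewrite at_.
  - near=> x; apply/andP; split.
      by apply: le_trans at_ _; near: x; exact: nbhs_right_ge.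
    by near: x; exact: nbhs_right_le.
  - near=> x; apply/andP; split; first by near: x; exact: nbhs_left_ge.
    by apply: le_trans _ tb; near: x; exact: nbhs_left_le.
have Gu : G x @[x --> xnbhs u] --> xext H u.
  apply: cvg_trans Hu; apply: near_eq_cvg; near=> x; apply/esym/GH.
  by near: x.
case: u uab {near_ab Hu} Gu => t /= tab Gt.
- exact: cvg_lim.
- exact: GH.
- exact: cvg_lim.
Unshelve. all: by end_near.
Qed.

(** A primitive is the limit of the products from [a], and so is determined on
    [a, b]; the value of the integral does not depend on the one selected. *)
Lemma lprod_primitive_unique (R : realType) (a b : R) (f : R -> R)
    (lam : nat -> seq R) (G H : R -> R) : a < b ->
  lprod_primitive a b lam f G -> lprod_primitive a b lam f H ->
  forall u, xitv a b u -> xext G u = xext H u.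
Proof.
move=> ab [_ Ga _ Glim _] [Hreg Ha _ Hlim _].
have GH t : a <= t <= b -> G t = H t.
  move=> /andP[]; rewrite le_eqVlt => /orP[/eqP<- _|at_ tb].
    by rewrite Ga Ha.
  have := Glim a t (lexx a) at_ tb; rewrite Ga divr1 => hG.
  have := Hlim a t (lexx a) at_ tb; rewrite Ha divr1 => hH.
  exact: (cvg_unique _ hG hH).
by move=> u uab; exact: (eq_xext ab Hreg GH).
Qed.

Theorem proposition40 (R : realType) (a b : R) (hab : a < b)
  (f : R -> R) (hf : regulated a b f)
  (lam : nat -> seq R) (hlam : Lambda a b lam)
  (hjump : [set t | a < t < b /\ left_jump f t * right_jump f t != 0]
             `<=` partition_points a lam)
  (hcvg : prod_integrable a b f (Pt a) (Pt b))
  (hnz : prod_integral a b f (Pt a) (Pt b) != 0) :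
  lprod_integrable a b lam f /\
  (forall u v : xpoint R, xsimplex a b (u, v) ->
     prod_integrable a b f u v /\
     lprod_integral a b lam f u v = prod_integral a b f u v).
Proof.
have [G0 app] := prod_integral_approximates hab hf hcvg hnz.
set G := prod_integral a b f (Pt a) in G0 app.
have Gprim : lprod_primitive a b lam f (fun t => G (Pt t)).
  by apply: approximates_lprod_primitive => //; exact: prod_integralaa.
have lint : lprod_integrable a b lam f by exists (fun t => G (Pt t)).
split=> // u v [/= uab vab uv].
have [_ Gext] := approximates_xext hab hf G0 app.
have getE w : xitv a b w ->
    xext (get [set G | lprod_primitive a b lam f G]) w = G w.
  move=> wab; rewrite -(Gext _ wab).
  exact: (lprod_primitive_unique hab (getPex lint) Gprim).
rewrite /lprod_integral !getE//; case: uv => [<-|uv].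
  by rewrite divff ?G0// prod_integralaa; split => //; left.
by have [? ->] := prod_integral_ratio hab app uab vab uv.
Qed.
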